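(* Let $k\ge2$ be an integer and $m,p\in\mathbb{N}$ with $m\le p$. Suppose that $f=h+\overline{g}$ is harmonic in $\mathbb{D}$, where $h(z)=\sum_{n=k}^{\infty}a_{pn+m}z^{pn+m}$ and $g(z)=\sum_{n=k}^{\infty}b_{pn+m}z^{pn+m}$, and $h,g\in\mathcal{B}_{pk+m}$. Define $$M_{pk+m}(h,r)=\sum_{n=k}^{\infty}|a_{pn+m}|r^{pn+m}+\left(\frac1{1+|a_{pk+m}|}+\frac{r^p}{1-r^p}\right)\sum_{n=k}^{\infty}|a_{pn+m}|^2r^{p(2n-k)+m},$$ and define $M_{pk+m}(g,r)$ by the same formula with the coefficients $b_{pn+m}$ of $g$ in place of $a_{pn+m}$. Then the inequality $$M_{pk+m}(h,r)+M_{pk+m}(g,r)\le1$$ is valid for $r\in[0,\theta_k]$, where $\theta_k$ is the unique root in $(0,1)$ of the equation $$(1-r^p)-r^{pk+m}(3-r^p)=0.$$ The upper bound $\theta_k$ cannot be improved, as $f(z)=h(z)+\overline{\lambda h(z)}$ shows, where $h(z)=z^{pk+m}$ and $|\lambda|=1$.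
   Context: $\mathbb{D}=\{z\in\mathbb{C}:|z|<1\}$ and $\mathbb N=\{1,2,\dots\}$. $\mathcal{B}$ is the class of analytic functions $\phi$ on $\mathbb{D}$ with $\sup_{z\in\mathbb{D}}|\phi(z)|\le1$, and for $j\in\mathbb{N}$, $\mathcal{B}_j=\{\phi\in\mathcal{B}:\phi(0)=\cdots=\phi^{(j-1)}(0)=0\}$. ''Cannot be improved'' means that $\theta_k$ cannot be replaced by any larger number in $(0,1)$ so that the inequality still holds for all such $f$; the displayed $f$ violates the inequality for every $r\in(\theta_k,1)$. *)

(* Defs.v *)
(* Stdlib reals with Coquelicot; complex numbers are Coquelicot's [C = R * R]. *)
From Stdlib Require Import Reals.
From Coquelicot Require Import Coquelicot.
Open Scope R_scope.

(* The functions below are total on [C]; only their values on the open unit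
   disk [D] are ever constrained. *)
Definition D (z : C) : Prop := Cmod z < 1.

(* [ex_derive] is elaborated over the absolute-value ring [C], so this is
   complex differentiability at every point of the disk. *)
Definition analytic_on_D (phi : C -> C) : Prop :=
  forall z : C, D z -> ex_derive (K := C_AbsRing) (V := C_NormedModule) phi z.

Definition class_B (phi : C -> C) : Prop :=
  analytic_on_D phi /\ forall z : C, D z -> Cmod (phi z) <= 1.

(* [C_derive] is a total operator agreeing with the complex derivative wherever
   the latter exists; for analytic [phi] its iterates on [D] are the successive
   derivatives of [phi]. *)
Definition class_Bj (j : nat) (phi : C -> C) : Prop :=
  class_B phi /\
  forall i : nat, (i < j)%nat -> Nat.iter i C_derive phi (RtoC 0) = RtoC 0.

Definition laplacian (u : R -> R -> R) (x y : R) : R :=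
  partial_derive 2 0 u x y + partial_derive 0 2 u x y.

(* [ex_diff_n u 2] at every point of the disk says that [u] is C^2 there. *)
Definition real_harmonic_on_D (u : R -> R -> R) : Prop :=
  forall x y : R, D (x, y) -> ex_diff_n u 2 x y /\ laplacian u x y = 0.

Definition harmonic_on_D (f : C -> C) : Prop :=
  real_harmonic_on_D (fun x y => Re (f (x, y))) /\
  real_harmonic_on_D (fun x y => Im (f (x, y))).

(* Sums over n >= k are reindexed by n = k + i. *)
Definition from {T : Type} (k : nat) (u : nat -> T) : nat -> T :=
  fun i => u (k + i)%nat.

(* h(z) = sum_{n >= k} a_{pn+m} z^{pn+m} on the disk; the values of [a] at the
   remaining indices are never used. *)
Definition lacunary_expansion (k m p : nat) (a : nat -> C) (h : C -> C) : Prop :=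
  forall z : C, D z ->
    is_series (K := C_AbsRing) (V := C_NormedModule)
      (from k (fun n => (a (p * n + m)%nat * z ^ (p * n + m))%C)) (h z).

Definition setting (k m p : nat) (f h g : C -> C) (a b : nat -> C) : Prop :=
  harmonic_on_D f /\
  (forall z : C, D z -> f z = (h z + Cconj (g z))%C) /\
  lacunary_expansion k m p a h /\
  lacunary_expansion k m p b g /\
  class_Bj (p * k + m) h /\
  class_Bj (p * k + m) g.

Definition M_term1 (m p : nat) (a : nat -> C) (r : R) (n : nat) : R :=
  Cmod (a (p * n + m)%nat) * r ^ (p * n + m).

(* The truncated subtraction is harmless: this is only used for n >= k. *)
Definition M_term2 (k m p : nat) (a : nat -> C) (r : R) (n : nat) : R :=
  Cmod (a (p * n + m)%nat) ^ 2 * r ^ (p * (2 * n - k) + m).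

Definition M (k m p : nat) (a : nat -> C) (r : R) : R :=
  Series (from k (M_term1 m p a r))
  + (1 / (1 + Cmod (a (p * k + m)%nat)) + r ^ p / (1 - r ^ p))
    * Series (from k (M_term2 k m p a r)).

(* [Series] is total, so a bound on [M] is meaningful only together with this. *)
Definition M_converges (k m p : nat) (a : nat -> C) (r : R) : Prop :=
  ex_series (from k (M_term1 m p a r)) /\
  ex_series (from k (M_term2 k m p a r)).

Definition monomial_coeff (N : nat) (c : C) : nat -> C :=
  fun n => if Nat.eqb n N then c else RtoC 0.

(* Main.v *)
Require Import Defs.
From Stdlib Require Import Reals Lra Lia FunctionalExtensionality.
From Coquelicot Require Import Coquelicot.
Open Scope R_scope.

(* Put c_i = a_{p(k+i)+m}, x_i = |c_i| and rho = r^p, so that h(z) = z^{pk+m} sum_i c_i z^{pi}.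
   Carlson's inequality x_s + sum_{j <= q} x_j^2 <= 1 for 2q < s holds because, with
   v(z) = sum_{j <= q} c_j z^j and P = e + z^s conj(v) for a suitable phase e, the mean over the
   unit circle of conj(e) z^{-s} (sum_i c_i z^i) P^2 is x_s + 2 sum_{j <= q} x_j^2, while that of
   |P|^2 is 1 + sum_{j <= q} x_j^2. The means are taken over roots of unity of large order, after
   truncating the series, so that only finite sums occur.
   Summing the inequality over s >= 1 with weights rho^s gives
   sum_{s >= 1} x_s rho^s + rho/(1-rho) sum_j x_j^2 rho^{2j} <= rho/(1-rho). As
   sum_j x_j^2 <= 1 and x_0 + 1/(1+x_0) <= 3/2 on [0,1], it follows that
   M <= r^{pk+m} (3-rho) / (2(1-rho)), with equality for monomials. *)

(** * Means over roots of unity *)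

(* Terms of [sum_n] are typed in [C_AbelianMonoid], which [ring] does not recognise. *)
Ltac cring := match goal with |- ?a = ?b => change (@eq C a b) end; ring.

Definition cis (t : R) : C := (cos t, sin t).

Lemma cis_add (s t : R) : cis (s + t) = (cis s * cis t)%C.
Proof.
  unfold cis, Cmult; simpl. rewrite cos_plus, sin_plus. f_equal; ring.
Qed.

Lemma cis_0 : cis 0 = RtoC 1.
Proof. unfold cis. now rewrite cos_0, sin_0. Qed.

Lemma cis_pow (t : R) (n : nat) : (cis t ^ n)%C = cis (INR n * t).
Proof.
  induction n as [|n IH].
  - simpl. now rewrite Rmult_0_l, cis_0.
  - rewrite S_INR, Cpow_S, IH, <- cis_add. f_equal; ring.
Qed.

Lemma Cmod_cis (t : R) : Cmod (cis t) = 1.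
Proof.
  unfold Cmod, cis; simpl.
  replace (cos t * (cos t * 1) + sin t * (sin t * 1)) with 1.
  - apply sqrt_1.
  - generalize (sin2_cos2 t). unfold Rsqr. lra.
Qed.

Lemma cis_full_turns (j : nat) : cis (2 * PI * INR j) = RtoC 1.
Proof.
  replace (2 * PI * INR j) with (0 + 2 * INR j * PI) by ring.
  unfold cis. rewrite cos_period, sin_period. apply cis_0.
Qed.

(** Half-angle formula: cos t = 1 - 2 sin^2(t/2), and sin(t/2) > 0 because 0 < t/2 < pi. *)
Lemma cis_neq_1 (t : R) : 0 < t < 2 * PI -> cis t <> RtoC 1.
Proof.
  intros Ht E. apply (f_equal fst) in E. simpl in E.
  replace t with (2 * (t / 2)) in E by field.
  rewrite cos_2a_sin in E.
  assert (0 < sin (t / 2)) by (apply sin_gt_0; lra).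
  nra.
Qed.

Lemma Cmod_1_conj (z : C) : Cmod z = 1 -> (z * Cconj z)%C = RtoC 1.
Proof. intros H. rewrite <- Cmod2_conj, H. f_equal. ring. Qed.

Lemma csum_plus (u v : nat -> C) (n : nat) :
  sum_n (fun i => (u i + v i)%C) n = (sum_n u n + sum_n v n)%C.
Proof. exact (sum_n_plus u v n). Qed.

Lemma csum_scal (c : C) (u : nat -> C) (n : nat) :
  sum_n (fun i => (c * u i)%C) n = (c * sum_n u n)%C.
Proof. exact (sum_n_mult_l (K := C_Ring) c u n). Qed.

Lemma csum_Sn (u : nat -> C) (n : nat) :
  sum_n u (S n) = (sum_n u n + u (S n))%C.
Proof. exact (sum_Sn u n). Qed.

Lemma csum_conj (u : nat -> C) (n : nat) :
  Cconj (sum_n u n) = sum_n (fun i => Cconj (u i)) n.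
Proof.
  induction n as [|n IH].
  - now rewrite !sum_O.
  - now rewrite !csum_Sn, Cplus_conj, IH.
Qed.

Lemma csum_Re (u : nat -> C) (n : nat) :
  Re (sum_n u n) = sum_n (fun i => Re (u i)) n.
Proof.
  induction n as [|n IH].
  - now rewrite !sum_O.
  - rewrite csum_Sn, re_plus, IH, sum_Sn. reflexivity.
Qed.

Lemma csum_RtoC (u : nat -> R) (n : nat) :
  sum_n (fun i => RtoC (u i)) n = RtoC (sum_n u n).
Proof.
  induction n as [|n IH].
  - now rewrite !sum_O.
  - rewrite csum_Sn, IH, sum_Sn, <- RtoC_plus. reflexivity.
Qed.

Lemma csum_geometric (w : C) (n : nat) :
  ((w - 1) * sum_n (fun l => w ^ l) n)%C = (w ^ S n - 1)%C.
Proof.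
  induction n as [|n IH].
  - rewrite sum_O. simpl. ring.
  - rewrite csum_Sn, Cmult_plus_distr_l, IH, (Cpow_S w (S n)). ring.
Qed.

Lemma csum_kronecker (j n : nat) (d : nat -> C) :
  sum_n (fun i => if Nat.eqb i j then d i else RtoC 0) n =
  if Nat.leb j n then d j else RtoC 0.
Proof.
  induction n as [|n IH].
  - rewrite sum_O. destruct j; reflexivity.
  - rewrite csum_Sn, IH.
    destruct (Nat.eqb_spec (S n) j); destruct (Nat.leb_spec j n);
      destruct (Nat.leb_spec j (S n)); try lia; subst; cring.
Qed.

(* There are [S N] points, so that the mean is never over an empty set. *)
Definition root (N l : nat) : C := cis (2 * PI * (INR l / INR (S N))).

Definition root_mean (N : nat) (f : C -> C) : C :=
  (/ RtoC (INR (S N)) * sum_n (fun l => f (root N l)) N)%C.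

Lemma INR_S_neq_0 (N : nat) : RtoC (INR (S N)) <> RtoC 0.
Proof. intros E. apply RtoC_inj in E. now apply (not_0_INR (S N)) in E. Qed.

Lemma root_mean_ext (N : nat) (f g : C -> C) :
  (forall z, Cmod z = 1 -> f z = g z) -> root_mean N f = root_mean N g.
Proof.
  intros H. unfold root_mean. f_equal. apply sum_n_ext. intros l.
  apply H, Cmod_cis.
Qed.

Lemma root_mean_plus (N : nat) (f g : C -> C) :
  root_mean N (fun z => f z + g z)%C = (root_mean N f + root_mean N g)%C.
Proof.
  unfold root_mean.
  rewrite (csum_plus (fun l => f (root N l)) (fun l => g (root N l))). ring.
Qed.

Lemma root_mean_scal (N : nat) (c : C) (f : C -> C) :
  root_mean N (fun z => c * f z)%C = (c * root_mean N f)%C.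
Proof.
  unfold root_mean. rewrite (csum_scal c (fun l => f (root N l))). ring.
Qed.

Lemma root_mean_sum (N n : nat) (f : nat -> C -> C) :
  root_mean N (fun z => sum_n (fun i => f i z) n) =
  sum_n (fun i => root_mean N (f i)) n.
Proof.
  unfold root_mean. rewrite csum_scal. f_equal.
  exact (sum_n_switch (fun l i => f i (root N l)) N n).
Qed.

Lemma root_mean_conj (N : nat) (f : C -> C) :
  root_mean N (fun z => Cconj (f z)) = Cconj (root_mean N f).
Proof.
  unfold root_mean.
  rewrite Cmult_conj, csum_conj, Cinv_conj by apply INR_S_neq_0.
  f_equal. f_equal. unfold Cconj, RtoC; simpl. f_equal. ring.
Qed.

Lemma root_mean_1 (N : nat) : root_mean N (fun _ => RtoC 1) = RtoC 1.
Proof.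
  unfold root_mean.
  rewrite (csum_RtoC (fun _ => 1)), sum_n_const, Rmult_1_r.
  apply Cinv_l, INR_S_neq_0.
Qed.

Lemma root_mean_Re_le (N : nat) (f g : C -> C) :
  (forall z, Cmod z = 1 -> Re (f z) <= Re (g z)) ->
  Re (root_mean N f) <= Re (root_mean N g).
Proof.
  intros H. unfold root_mean.
  assert (P : 0 < INR (S N)) by (apply lt_0_INR; lia).
  rewrite <- RtoC_inv, !re_scal_l, !csum_Re by lra.
  apply Rmult_le_compat_l.
  - left. now apply Rinv_0_lt_compat.
  - rewrite !sum_n_Reals. apply sum_Rle. intros l _. apply H, Cmod_cis.
Qed.

(** The values z^j are the powers of one number w with w^(N+1) = 1, and w <> 1 because 0 < j < N+1;
    the geometric sum therefore vanishes. *)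
Lemma root_mean_pow (N j : nat) :
  (0 < j <= N)%nat -> root_mean N (fun z => z ^ j)%C = RtoC 0.
Proof.
  intros Hj. unfold root_mean.
  assert (P : 0 < INR (S N)) by (apply lt_0_INR; lia).
  set (w := cis (2 * PI * (INR j / INR (S N)))).
  rewrite (sum_n_ext _ (fun l => w ^ l)%C).
  2:{ intros l. unfold w, root. rewrite !cis_pow. f_equal. field. lra. }
  assert (Hw : w <> RtoC 1).
  { apply cis_neq_1.
    assert (0 < INR j / INR (S N) < 1).
    { split.
      - apply Rdiv_lt_0_compat; auto. apply lt_0_INR; lia.
      - apply Rlt_div_l; auto. rewrite Rmult_1_l. apply lt_INR; lia. }
    generalize PI_RGT_0. nra. }
  assert (E : ((w - 1) * sum_n (fun l => w ^ l) N)%C = RtoC 0).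
  { rewrite csum_geometric. unfold w. rewrite cis_pow.
    replace (INR (S N) * (2 * PI * (INR j / INR (S N)))) with (2 * PI * INR j)
      by (field; lra).
    rewrite cis_full_turns. ring. }
  assert (E' : sum_n (fun l => w ^ l)%C N = RtoC 0).
  { apply (f_equal (Cmult (/ (w - 1)))) in E.
    rewrite Cmult_assoc, Cinv_l, Cmult_1_l in E.
    - rewrite E. cring.
    - intros F. apply Hw. replace w with ((w - 1) + 1)%C by ring. rewrite F. ring. }
  rewrite E'. ring.
Qed.

Lemma conj_pow_mult_pow (z : C) (i j : nat) :
  Cmod z = 1 -> (i <= j)%nat -> (Cconj (z ^ i) * z ^ j)%C = (z ^ (j - i))%C.
Proof.
  intros Hz H. replace j with ((j - i) + i)%nat at 1 by lia.
  rewrite Cpow_add_r.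
  replace (Cconj (z ^ i) * (z ^ (j - i) * z ^ i))%C
    with (z ^ (j - i) * (z ^ i * Cconj (z ^ i)))%C by ring.
  rewrite Cmod_1_conj; [ring|]. now rewrite Cmod_pow, Hz, pow1.
Qed.

(** Discrete orthogonality: on the circle the product is z^(j-i) or the conjugate of z^(i-j), and a
    nonzero difference of size at most N is not a multiple of N+1. *)
Lemma root_mean_conj_pow_pow (N i j : nat) :
  (i <= N)%nat -> (j <= N)%nat ->
  root_mean N (fun z => Cconj (z ^ i) * z ^ j)%C =
  if Nat.eqb j i then RtoC 1 else RtoC 0.
Proof.
  intros Hi Hj. destruct (Nat.eqb_spec j i) as [->|E].
  - rewrite <- (root_mean_1 N). apply root_mean_ext. intros z Hz.
    rewrite conj_pow_mult_pow, Nat.sub_diag by auto. reflexivity.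
  - destruct (Nat.lt_ge_cases i j) as [L|L].
    + rewrite (root_mean_ext N _ (fun z => z ^ (j - i))%C).
      * apply root_mean_pow. lia.
      * intros z Hz. apply conj_pow_mult_pow; auto; lia.
    + rewrite (root_mean_ext N _ (fun z => Cconj (z ^ (i - j)))%C).
      * rewrite root_mean_conj, root_mean_pow by lia.
        unfold Cconj; simpl. unfold RtoC. f_equal. ring.
      * intros z Hz. rewrite <- (conj_pow_mult_pow z j i) by (auto; lia).
        rewrite Cmult_conj, Cconj_conj. ring.
Qed.

Definition cpoly (d : nat -> C) (n : nat) (z : C) : C :=
  sum_n (fun i => d i * z ^ i)%C n.

Lemma root_mean_coef (N j n : nat) (d : nat -> C) :
  (j <= N)%nat -> (n <= N)%nat ->
  root_mean N (fun z => Cconj (z ^ j) * cpoly d n z)%C =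
  if Nat.leb j n then d j else RtoC 0.
Proof.
  intros Hj Hn.
  rewrite (root_mean_ext N _
    (fun z => sum_n (fun i => d i * (Cconj (z ^ j) * z ^ i))%C n)).
  2:{ intros z _. unfold cpoly. rewrite <- csum_scal. apply sum_n_ext.
      intros i. cring. }
  rewrite root_mean_sum, <- csum_kronecker.
  apply sum_n_ext_loc. intros i Hi.
  rewrite root_mean_scal, root_mean_conj_pow_pow by lia.
  destruct (Nat.eqb i j); cring.
Qed.

Lemma root_mean_conj_cpoly (N q : nat) (c : nat -> C) (f : C -> C) :
  root_mean N (fun z => Cconj (cpoly c q z) * f z)%C =
  sum_n (fun j => Cconj (c j) * root_mean N (fun z => Cconj (z ^ j) * f z))%C q.
Proof.
  rewrite (root_mean_ext N _
    (fun z => sum_n (fun j => Cconj (c j) * (Cconj (z ^ j) * f z))%C q)).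
  2:{ intros z _. unfold cpoly. rewrite csum_conj, Cmult_comm, <- csum_scal.
      apply sum_n_ext. intros i. rewrite Cmult_conj. cring. }
  rewrite root_mean_sum. apply sum_n_ext. intros j.
  apply root_mean_scal.
Qed.

(* Frequencies in [-B, -a) are absent from [f]. *)
Definition no_frequency (N a B : nat) (f : C -> C) : Prop :=
  forall k, (a < k <= B)%nat -> root_mean N (fun z => z ^ k * f z)%C = RtoC 0.

(** After multiplication by z^k all exponents k + i lie between 1 and N, so there is no aliasing
    modulo N+1. *)
Lemma no_frequency_cpoly (N B n : nat) (d : nat -> C) :
  (B + n <= N)%nat -> no_frequency N 0 B (cpoly d n).
Proof.
  intros H k Hk.
  rewrite (root_mean_ext N _ (fun z => sum_n (fun i => d i * z ^ (k + i))%C n)).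
  2:{ intros z _. unfold cpoly. rewrite <- csum_scal. apply sum_n_ext.
      intros i. rewrite Cpow_add_r. cring. }
  rewrite root_mean_sum.
  rewrite (sum_n_ext_loc _ (fun _ => (0 * 0)%C)).
  - rewrite csum_scal. ring.
  - intros i Hi. rewrite root_mean_scal, root_mean_pow by lia. cring.
Qed.

(** On the circle the conjugate of z^j with j <= q lowers frequencies by at most q, so the gap
    begins q places lower. *)
Lemma no_frequency_conj_cpoly (N a B q : nat) (c : nat -> C) (f : C -> C) :
  no_frequency N a B f ->
  no_frequency N (a + q) B (fun z => Cconj (cpoly c q z) * f z)%C.
Proof.
  intros H k Hk.
  rewrite (root_mean_ext N _ (fun z => Cconj (cpoly c q z) * (z ^ k * f z))%C)
    by (intros; ring).
  rewrite root_mean_conj_cpoly.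
  rewrite (sum_n_ext_loc _ (fun _ => (0 * 0)%C)).
  - rewrite csum_scal. ring.
  - intros j Hj.
    rewrite (root_mean_ext N _ (fun z => z ^ (k - j) * f z)%C).
    + rewrite H by lia. cring.
    + intros z Hz. rewrite <- (conj_pow_mult_pow z j k) by (auto; lia). ring.
Qed.

Lemma unit_phase (x : C) : exists e, Cmod e = 1 /\ (e * x)%C = RtoC (Cmod x).
Proof.
  destruct (Req_dec (Cmod x) 0) as [E|E].
  - exists (RtoC 1). split; [apply Cmod_1|].
    rewrite E, (Cmod_eq_0 x E). ring.
  - assert (N : RtoC (Cmod x) <> RtoC 0) by (intros F; now apply RtoC_inj in F).
    exists (Cconj x / Cmod x)%C. split.
    + rewrite Cmod_div, Cmod_conj, Cmod_R, Rabs_pos_eq by (auto; apply Cmod_ge_0).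
      now field.
    + replace (Cconj x / Cmod x * x)%C with ((x * Cconj x) / Cmod x)%C
        by (field; auto).
      rewrite <- Cmod2_conj. rewrite <- RtoC_div by auto. f_equal. now field.
Qed.

(** * Carlson's inequality *)

Definition sqnorm (d : nat -> C) (q : nat) : R :=
  sum_n (fun j => Cmod (d j) ^ 2) q.

Lemma root_mean_sqnorm (N n q : nat) (d : nat -> C) :
  (q <= n)%nat -> (n <= N)%nat ->
  root_mean N (fun z => Cconj (cpoly d q z) * cpoly d n z)%C =
  RtoC (sqnorm d q).
Proof.
  intros Hq Hn. rewrite root_mean_conj_cpoly. unfold sqnorm.
  rewrite <- csum_RtoC. apply sum_n_ext_loc. intros j Hj.
  rewrite root_mean_coef by lia.
  destruct (Nat.leb_spec j n); [|lia].
  rewrite Cmod2_conj. cring.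
Qed.

(** The argument with the test function P, for polynomials. The bound [K] is left free because
    truncations of a series bounded by 1 are only bounded by 1 + eps on the circle. *)
Lemma cpoly_coef_bound (n q s : nat) (d : nat -> C) (K : R) :
  (2 * q < s)%nat -> (s <= n)%nat ->
  (forall z, Cmod z = 1 -> Cmod (cpoly d n z) <= K) ->
  Cmod (d s) + 2 * sqnorm d q <= K * (1 + sqnorm d q).
Proof.
  intros Hq Hs HK.
  destruct (unit_phase (d s)) as [e [He Hes]].
  (* [no_frequency_cpoly], used with B = s and degree n, asks for s + n <= N. *)
  pose (N := (s + n)%nat).
  pose (v := cpoly d q). pose (S := cpoly d n).
  pose (P := fun z : C => (e + z ^ s * Cconj (v z))%C).
  pose (F := fun z : C => (Cconj e * (Cconj (z ^ s) * (P z * P z * S z)))%C).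
  pose (G := fun z : C => (P z * Cconj (P z))%C).
  assert (Ee : (e * Cconj e)%C = RtoC 1) by now apply Cmod_1_conj.
  assert (Ez : forall z, Cmod z = 1 -> (z ^ s * Cconj (z ^ s))%C = RtoC 1).
  { intros z Hz. apply Cmod_1_conj. now rewrite Cmod_pow, Hz, pow1. }
  assert (MF : root_mean N F = RtoC (Cmod (d s) + 2 * sqnorm d q)).
  (* Expand P^2 using |e| = |z^s| = 1. The means of the three terms are e d_s = |d_s|, twice
     [sqnorm d q], and 0: conj(v)^2 S has no frequency below -2q, and s > 2q. *)
  { rewrite (root_mean_ext N F (fun z =>
      e * (Cconj (z ^ s) * S z) + 2 * (Cconj (v z) * S z)
      + Cconj e * (z ^ s * (Cconj (v z) * (Cconj (v z) * S z))))%C).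
    - rewrite !root_mean_plus, !root_mean_scal.
      unfold v, S. rewrite root_mean_coef, root_mean_sqnorm by (unfold N; lia).
      destruct (Nat.leb_spec s n); [|lia].
      rewrite Hes.
      assert (Z : no_frequency N (0 + q + q) s (fun z => Cconj (cpoly d q z) *
                   (Cconj (cpoly d q z) * cpoly d n z))%C).
      { apply (no_frequency_conj_cpoly _ _ _ _ _
                 (fun z => Cconj (cpoly d q z) * cpoly d n z)%C).
        apply no_frequency_conj_cpoly, no_frequency_cpoly. unfold N; lia. }
      rewrite (Z s) by lia.
      rewrite RtoC_plus, RtoC_mult. ring.
    - intros z Hz. unfold F, P. specialize (Ez z Hz).
      set (zs := (z ^ s)%C) in *. set (V := Cconj (v z)).
      transitivity ((e * Cconj e) * e * Cconj zs * S z
        + 2 * (e * Cconj e) * (zs * Cconj zs) * V * S z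
        + Cconj e * (zs * Cconj zs) * zs * V * V * S z)%C; [ring|].
      rewrite Ee, Ez. ring. }
  assert (MG : root_mean N G = RtoC (1 + sqnorm d q)).
  (* |P|^2 is 1 + |v|^2 plus a cross term and its conjugate; the cross term has mean 0 because v has
     degree at most q < s. *)
  { rewrite (root_mean_ext N G (fun z =>
      1 + Cconj (v z) * v z + e * (Cconj (z ^ s) * v z)
      + Cconj (e * (Cconj (z ^ s) * v z)))%C).
    - rewrite !root_mean_plus, root_mean_conj, root_mean_scal, root_mean_1.
      unfold v. rewrite root_mean_coef, root_mean_sqnorm by (unfold N; lia).
      destruct (Nat.leb_spec s q); [lia|].
      rewrite Cmult_0_r, RtoC_plus.
      replace (Cconj 0) with (RtoC 0) by (unfold Cconj, RtoC; simpl; f_equal; ring).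
      ring.
    - intros z Hz. unfold G, P. specialize (Ez z Hz).
      rewrite Cplus_conj, !Cmult_conj, !Cconj_conj.
      set (zs := (z ^ s)%C) in *. set (V := Cconj (v z)).
      transitivity ((e * Cconj e) + (zs * Cconj zs) * (V * v z)
         + e * (Cconj zs * v z) + Cconj e * (zs * V))%C; [ring|].
      rewrite Ee, Ez. ring. }
  (* On the circle |F| = |P|^2 |S| <= K |P|^2, and G = |P|^2. *)
  assert (L : Re (root_mean N F) <= Re (root_mean N (fun z => RtoC K * G z)%C)).
  { apply root_mean_Re_le. intros z Hz.
    apply Rle_trans with (1 := Rle_abs _).
    apply Rle_trans with (1 := re_le_Cmod _).
    unfold F, G. rewrite <- Cmod2_conj, <- RtoC_mult, re_RtoC.
    rewrite !Cmod_mult, !Cmod_conj, Cmod_pow, Hz, pow1, He.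
    specialize (HK z Hz). fold (S z) in HK.
    generalize (Cmod_ge_0 (P z)). nra. }
  rewrite root_mean_scal, MF, MG, <- RtoC_mult, !re_RtoC in L. exact L.
Qed.

(** * From polynomials to power series on the disk *)

Lemma is_series_C_spec (u : nat -> C) (l : C) :
  is_series (K := C_AbsRing) (V := C_NormedModule) u l <->
  forall eps : posreal, exists N : nat, forall n : nat, (N <= n)%nat ->
    Cmod (sum_n u n - l)%C < eps.
Proof.
  unfold is_series.
  rewrite (filterlim_locally_ball_norm (K := C_AbsRing) (U := C_NormedModule)).
  reflexivity.
Qed.

Lemma cis_surj (z : C) : Cmod z = 1 -> exists t, z = cis t.
Proof.
  destruct z as [x y]. intros Hz.
  assert (H : x ^ 2 + y ^ 2 = 1).
  { generalize (Cmod2_alt (x, y)). rewrite Hz. simpl. lra. }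
  assert (Hx : -1 <= x <= 1) by nra.
  destruct (Rle_lt_dec 0 y) as [Hy|Hy].
  - exists (acos x). unfold cis. rewrite cos_acos, sin_acos by lra. f_equal.
    rewrite <- (sqrt_Rsqr y) by auto. f_equal. unfold Rsqr. lra.
  - exists (- acos x). unfold cis.
    rewrite cos_neg, sin_neg, cos_acos, sin_acos by lra. f_equal.
    rewrite <- (Ropp_involutive y). f_equal.
    rewrite <- (sqrt_Rsqr (- y)) by lra. f_equal. unfold Rsqr. lra.
Qed.

(** Absolute summability makes the tails small uniformly on the circle, so one [L] serves every z.
    The index n' depends on z but only mediates: one eps pays for the tail, the other for
    convergence at z. *)
Lemma cpoly_uniform_bound (d : nat -> C) (eps : posreal) :
  ex_series (fun i => Cmod (d i)) ->
  (forall z, Cmod z = 1 -> exists l,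
     is_series (K := C_AbsRing) (V := C_NormedModule) (fun i => d i * z ^ i)%C l
     /\ Cmod l <= 1) ->
  exists L, forall n, (L <= n)%nat -> forall z, Cmod z = 1 ->
    Cmod (cpoly d n z) <= 1 + 2 * eps.
Proof.
  intros Hd Hb.
  apply (Cauchy_ex_series (V := R_CompleteNormedModule)) in Hd.
  destruct (Hd eps) as [L HL]. exists L. intros n Hn z Hz.
  destruct (Hb z Hz) as [l [Hl Hl1]].
  destruct (proj1 (is_series_C_spec _ _) Hl eps) as [N HN].
  pose (n' := S (Nat.max N n)).
  specialize (HN n' ltac:(unfold n'; lia)). fold (cpoly d n' z) in HN.
  assert (T : Cmod (cpoly d n' z - cpoly d n z)%C < eps).
  { replace (cpoly d n' z - cpoly d n z)%C
      with (sum_n_m (fun i => d i * z ^ i)%C (S n) n')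
      by exact (sum_n_m_sum_n (G := C_AbelianGroup) _ n n'
                  ltac:(unfold n'; lia)).
    eapply Rle_lt_trans.
    - exact (norm_sum_n_m (V := C_NormedModule) (fun i => d i * z ^ i)%C (S n) n').
    - eapply Rle_lt_trans; [|exact (HL (S n) n' ltac:(lia) ltac:(unfold n'; lia))].
      eapply Rle_trans; [|apply Rle_abs].
      apply sum_n_m_le. intros i.
      change (Cmod (d i * z ^ i)%C <= Cmod (d i)).
      rewrite Cmod_mult, Cmod_pow, Hz, pow1. lra. }
  replace (cpoly d n z) with
    (l + ((cpoly d n' z - l) + - (cpoly d n' z - cpoly d n z)))%C by ring.
  generalize (Cmod_triangle l ((cpoly d n' z - l) + - (cpoly d n' z - cpoly d n z))%C)
    (Cmod_triangle (cpoly d n' z - l)%C (- (cpoly d n' z - cpoly d n z))%C).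
  rewrite Cmod_opp. lra.
Qed.

Lemma sqnorm_ge_0 (d : nat -> C) (q : nat) : 0 <= sqnorm d q.
Proof.
  unfold sqnorm. rewrite sum_n_Reals. apply cond_pos_sum. intros j.
  apply pow2_ge_0.
Qed.

Lemma carlson_circle (d : nat -> C) (q s : nat) :
  ex_series (fun i => Cmod (d i)) ->
  (forall z, Cmod z = 1 -> exists l,
     is_series (K := C_AbsRing) (V := C_NormedModule) (fun i => d i * z ^ i)%C l
     /\ Cmod l <= 1) ->
  (2 * q < s)%nat -> Cmod (d s) + sqnorm d q <= 1.
Proof.
  intros Hd Hb Hq. apply Rle_plus_epsilon. intros eps Heps.
  generalize (sqnorm_ge_0 d q). intros Hpos.
  (* This tolerance, put in place of eps in the factor 1 + 2 eps, turns the bound into 1 +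
     [sqnorm d q] + eps. *)
  assert (He : 0 < eps / (2 * (1 + sqnorm d q))) by (apply Rdiv_lt_0_compat; lra).
  destruct (cpoly_uniform_bound d (mkposreal _ He) Hd Hb) as [L HL].
  generalize (cpoly_coef_bound (Nat.max L s) q s d _ Hq ltac:(lia)
    (HL (Nat.max L s) ltac:(lia))). simpl.
  replace ((1 + 2 * (eps / (2 * (1 + sqnorm d q)))) * (1 + sqnorm d q))
    with (1 + sqnorm d q + eps) by (field; lra).
  lra.
Qed.

Lemma bernoulli_lower (e : R) (n : nat) :
  0 <= e <= 1 -> 1 - INR n * e <= (1 - e) ^ n.
Proof.
  intros He. induction n as [|n IH]; [simpl; lra|].
  rewrite S_INR. simpl.
  apply Rle_trans with ((1 - e) * (1 - INR n * e)).
  - generalize (pos_INR n). nra.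
  - apply Rmult_le_compat_l; lra.
Qed.

(** Replaces the passage to the limit rho -> 1 by one explicit choice of rho. *)
Lemma scaled_le_1 (X : R) (K : nat) :
  (forall rho, 0 < rho < 1 -> rho ^ K * X <= 1) -> X <= 1.
Proof.
  intros H. destruct (Rle_lt_dec X 1) as [|HX]; auto. exfalso.
  assert (HK : 0 <= INR K) by apply pos_INR.
  (* This e satisfies e X (1 + K) = (X - 1)/2, so Bernoulli's inequality gives (1 - e)^K X >= (X +
     1)/2 > 1. *)
  pose (e := (X - 1) / (2 * X * (1 + INR K))).
  assert (He : 0 < e) by (apply Rdiv_lt_0_compat; [lra|apply Rmult_lt_0_compat; lra]).
  assert (Ee : e * (2 * X * (1 + INR K)) = X - 1) by (unfold e; field; nra).
  assert (HeK : 0 <= e * X * INR K) by (apply Rmult_le_pos; nra).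
  assert (He1 : e < 1) by nra.
  specialize (H (1 - e) ltac:(lra)).
  generalize (bernoulli_lower e K ltac:(lra)).
  nra.
Qed.

Definition lacunary_coef (k m p : nat) (a : nat -> C) (i : nat) : C :=
  a (p * (k + i) + m)%nat.

(** Abel's lemma: convergence at a point t strictly between rho and 1 bounds the terms there, and
    comparison with powers of rho/t gives absolute convergence at rho. *)
Lemma lacunary_summable (k m p : nat) (a : nat -> C) (h : C -> C) (rho : R) :
  (1 <= p)%nat -> lacunary_expansion k m p a h -> 0 < rho < 1 ->
  ex_series (fun i => Cmod (lacunary_coef k m p a i) * rho ^ (p * (k + i) + m)).
Proof.
  intros Hp Hh Hr. pose (t := (1 + rho) / 2).
  assert (Ht : 0 < rho < t /\ t < 1) by (unfold t; lra).
  assert (HD : Defs.D (RtoC t)) by (unfold Defs.D; rewrite Cmod_R, Rabs_pos_eq; lra).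
  assert (Hhalf : 0 < / 2) by lra.
  destruct (proj1 (is_series_C_spec _ _) (Hh _ HD) (mkposreal _ Hhalf)) as [N HN].
  apply (ex_series_incr_n (V := R_NormedModule) _ (S N)).
  pose (x := rho / t).
  assert (Hx : 0 < x < 1).
  { unfold x. split; [apply Rdiv_lt_0_compat; lra|].
    apply Rlt_div_l; lra. }
  apply (ex_series_le (V := R_CompleteNormedModule) _ (fun i => x ^ i)).
  2:{ apply ex_series_geom. rewrite Rabs_pos_eq; lra. }
  intros i. set (j := (N + i)%nat). replace (S N + i)%nat with (S j) by (unfold j; lia).
  set (n := (p * (k + S j) + m)%nat).
  (* The term is a difference of consecutive partial sums, each within 1/2 of [h t]. *)
  assert (T : Cmod (a n) * t ^ n <= 1).
  { generalize (HN (S j) ltac:(unfold j; lia)) (HN j ltac:(unfold j; lia)).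
    rewrite csum_Sn. set (S0 := sum_n _ j). unfold from at 1. fold n. simpl.
    intros H1 H2.
    replace (Cmod (a n) * t ^ n) with (Cmod (a n * RtoC t ^ n)%C).
    - replace (a n * RtoC t ^ n)%C with
        ((S0 + a n * RtoC t ^ n - h t) + - (S0 - h t))%C by cring.
      eapply Rle_trans; [apply Cmod_triangle|]. rewrite Cmod_opp.
      apply Rlt_le. replace 1 with (/ 2 + / 2) by field.
      apply Rplus_lt_compat; [exact H1|exact H2].
    - rewrite Cmod_mult, Cmod_pow, Cmod_R, Rabs_pos_eq by lra. reflexivity. }
  assert (E : rho ^ n = x ^ n * t ^ n).
  { rewrite <- Rpow_mult_distr. f_equal. unfold x. field. lra. }
  (* As p >= 1, the exponent n is at least i, and 0 < x < 1. *)
  assert (Hxn : 0 < x ^ n <= x ^ i).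
  { split; [apply pow_lt; lra|].
    replace n with ((n - i) + i)%nat by (unfold n, j; nia).
    rewrite pow_add. rewrite <- (Rmult_1_l (x ^ i)) at 2.
    apply Rmult_le_compat_r; [apply pow_le; lra|].
    rewrite <- (pow1 (n - i)). apply pow_incr. lra. }
  change (Rabs (Cmod (lacunary_coef k m p a (S j)) * rho ^ n) <= x ^ i).
  unfold lacunary_coef. fold n.
  assert (0 < t ^ n) by (apply pow_lt; lra).
  generalize (Cmod_ge_0 (a n)). intros Ha.
  rewrite Rabs_pos_eq by (rewrite E; apply Rmult_le_pos; [|left; apply Rmult_lt_0_compat]; tauto).
  rewrite E. nra.
Qed.

(** [carlson_circle] applies on the circle of radius rho < 1, where the series is absolutely
    summable; then rho is sent to 1. *)
Lemma carlson_lacunary (k m p : nat) (a : nat -> C) (h : C -> C) (q s : nat) :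
  (1 <= p)%nat -> lacunary_expansion k m p a h ->
  (forall z, Defs.D z -> Cmod (h z) <= 1) -> (2 * q < s)%nat ->
  Cmod (lacunary_coef k m p a s) + sqnorm (lacunary_coef k m p a) q <= 1.
Proof.
  intros Hp Hh Hb Hq. set (c := lacunary_coef k m p a).
  pose (n := fun i => (p * (k + i) + m)%nat).
  (* The powers of rho that arise are rho^(n s) and rho^(2 n j) with j <= q < s; all are at least
     rho^(2 n s). *)
  apply (scaled_le_1 _ (2 * n s)). intros rho Hr.
  pose (d := fun i => (c i * RtoC rho ^ n i)%C).
  assert (Ed : forall i, Cmod (d i) = Cmod (c i) * rho ^ n i).
  { intros i. unfold d. rewrite Cmod_mult, Cmod_pow, Cmod_R, Rabs_pos_eq by lra.
    reflexivity. }
  assert (L : Cmod (d s) + sqnorm d q <= 1).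
  { apply carlson_circle; auto.
    - eapply ex_series_ext; [|exact (lacunary_summable k m p a h rho Hp Hh Hr)].
      intros i. now rewrite Ed.
    - intros z Hz. destruct (cis_surj z Hz) as [t ->].
      assert (Hp0 : INR p <> 0) by (apply not_0_INR; lia).
      (* w/rho is a p-th root of z, and the unimodular u cancels the phase of w^(pk+m); thus u h(w)
         is the sum of the d_i z^i. *)
      pose (w := (RtoC rho * cis (t / INR p))%C).
      pose (u := cis (- (INR (p * k + m) * (t / INR p)))).
      assert (Hw : Defs.D w).
      { unfold Defs.D, w. rewrite Cmod_mult, Cmod_cis, Cmod_R, Rabs_pos_eq; lra. }
      exists (u * h w)%C. split.
      + eapply is_series_ext;
          [|exact (is_series_scal (V := C_NormedModule) u _ _ (Hh w Hw))].
        intros i. change (u * (a (n i) * w ^ n i) = d i * cis t ^ i)%C.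
        unfold d, w, c, u, lacunary_coef. fold (n i).
        rewrite Cpow_mult_l, !cis_pow.
        replace (INR i * t)
          with (- (INR (p * k + m) * (t / INR p)) + INR (n i) * (t / INR p)).
        * rewrite cis_add. ring.
        * unfold n. rewrite !plus_INR, !mult_INR, plus_INR. now field.
      + unfold u. rewrite Cmod_mult, Cmod_cis, Rmult_1_l. auto. }
  assert (Hmono : forall i j, (i <= j)%nat -> rho ^ j <= rho ^ i).
  { intros i j Hij. replace j with ((j - i) + i)%nat by lia. rewrite pow_add.
    rewrite <- (Rmult_1_l (rho ^ i)) at 2.
    apply Rmult_le_compat_r; [apply pow_le; lra|].
    rewrite <- (pow1 (j - i)). apply pow_incr. lra. }
  eapply Rle_trans; [|exact L].
  rewrite Rmult_plus_distr_l. apply Rplus_le_compat.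
  - rewrite Ed, Rmult_comm. apply Rmult_le_compat_l; [apply Cmod_ge_0|].
    apply Hmono. lia.
  - unfold sqnorm. rewrite !sum_n_Reals, scal_sum. apply sum_Rle. intros j Hj.
    rewrite Ed, Rpow_mult_distr, <- pow_mult.
    apply Rmult_le_compat_l; [apply pow2_ge_0|].
    apply Hmono. unfold n. nia.
Qed.
(** * The Bohr-type estimate *)

(* Summing [x_s rho^s <= rho^s (1 - sum_(j <= (s-1)/2) x_j^2)] over [1 <= s <= 2q+2]. *)
Lemma carlson_partial_sum (x : nat -> R) (rho : R) (q : nat) :
  (forall q s, (2 * q < s)%nat -> x s + sum_f_R0 (fun j => x j ^ 2) q <= 1) ->
  0 <= rho < 1 ->
  (1 - rho) * (sum_f_R0 (fun i => x i * rho ^ i) (2 * q + 2) - x 0%nat)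
  + rho * sum_f_R0 (fun j => x j ^ 2 * rho ^ (2 * j)) q
  <= rho - rho ^ (2 * q + 3) * (1 - sum_f_R0 (fun j => x j ^ 2) q).
Proof.
  intros Hc Hr. induction q as [|q IH].
  - generalize (Hc 0%nat 1%nat ltac:(lia)) (Hc 0%nat 2%nat ltac:(lia)).
    simpl. intros H1 H2.
    apply (Rmult_le_compat_l ((1 - rho) * rho)) in H1; [|nra].
    apply (Rmult_le_compat_l ((1 - rho) * rho * rho)) in H2; [|nra].
    lra.
  - replace (2 * S q + 2)%nat with (S (S (2 * q + 2))) by lia.
    (* The new indices s = 2q+3 and s = 2q+4 both admit j up to q+1. Their weights (1 - rho) rho^s
       add up to rho^(2q+3) - rho^(2q+5), which moves the boundary term from q to q+1. *)
    generalize (Hc (S q) (S (2 * q + 2)) ltac:(lia))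
      (Hc (S q) (S (S (2 * q + 2))) ltac:(lia)).
    rewrite !tech5.
    replace (2 * S q + 3)%nat with (S (S (S (2 * q + 2)))) by lia.
    replace (2 * S q)%nat with (2 * q + 2)%nat by lia.
    replace (2 * q + 3)%nat with (S (2 * q + 2)) in IH by lia.
    rewrite <- !tech_pow_Rmult in *.
    assert (HR : 0 <= rho ^ (2 * q + 2)) by (apply pow_le; lra).
    set (T := rho ^ (2 * q + 2)) in *. intros H1 H2.
    apply (Rmult_le_compat_l ((1 - rho) * rho * T)) in H1.
    2:{ apply Rmult_le_pos; nra. }
    apply (Rmult_le_compat_l ((1 - rho) * rho * rho * T)) in H2.
    2:{ apply Rmult_le_pos; [|auto]. apply Rmult_le_pos; nra. }
    lra.
Qed.

(** The first series is cut at 2q + 2 and the second at q, the lengths matched in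
    [carlson_partial_sum]; the resulting bound is uniform in q and passes to the limit. *)
Lemma bohr_bound (x : nat -> R) (rho : R) :
  (forall i, 0 <= x i) ->
  (forall q s, (2 * q < s)%nat -> x s + sum_f_R0 (fun j => x j ^ 2) q <= 1) ->
  0 <= rho < 1 ->
  ex_series (fun i => x i * rho ^ i) ->
  ex_series (fun i => x i ^ 2 * rho ^ (2 * i)) ->
  Series (fun i => x i * rho ^ i)
  + (1 / (1 + x 0%nat) + rho / (1 - rho)) * Series (fun i => x i ^ 2 * rho ^ (2 * i))
  <= (3 - rho) / (2 * (1 - rho)).
Proof.
  intros Hx Hc Hr HX HY.
  set (kappa := 1 / (1 + x 0%nat) + rho / (1 - rho)).
  apply Series_correct in HX.
  apply (is_lim_seq_subseq (sum_n _) (Finite _) (fun q => 2 * q + 2)%nat) in HX.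
  2:{ apply eventually_subseq. intros n. lia. }
  apply Series_correct in HY.
  refine (is_lim_seq_le
    (fun q => sum_n (fun i => x i * rho ^ i) (2 * q + 2)
              + kappa * sum_n (fun i => x i ^ 2 * rho ^ (2 * i)) q)
    (fun _ => (3 - rho) / (2 * (1 - rho))) (Finite _) (Finite _) _ _ _).
  - intros q. rewrite !sum_n_Reals. unfold kappa.
    generalize (carlson_partial_sum x rho q Hc Hr).
    assert (HWY : sum_f_R0 (fun i => x i ^ 2 * rho ^ (2 * i)) q
                  <= sum_f_R0 (fun j => x j ^ 2) q).
    { apply sum_Rle. intros j _. rewrite <- (Rmult_1_r (x j ^ 2)) at 2.
      apply Rmult_le_compat_l; [apply pow2_ge_0|].
      rewrite <- (pow1 (2 * j)). apply pow_incr. lra. }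
    assert (HW : sum_f_R0 (fun j => x j ^ 2) q <= 1).
    { generalize (Hc q (S (2 * q)) ltac:(lia)) (Hx (S (2 * q))). lra. }
    assert (Hx0 : x 0%nat <= 1).
    { generalize (Hc 0%nat 1%nat ltac:(lia)) (Hx 1%nat). simpl. nra. }
    generalize (Hx 0%nat).
    set (X := sum_f_R0 _ (2 * q + 2)) in *. set (Y := sum_f_R0 _ q) in *.
    set (W := sum_f_R0 _ q) in *. set (x0 := x 0%nat) in *.
    assert (HT : 0 <= rho ^ (2 * q + 3)) by (apply pow_le; lra).
    intros Hx00 HP.
    assert (HP' : (1 - rho) * (X - x0) + rho * Y <= rho) by nra.
    apply Rle_trans with (x0 + 1 / (1 + x0) + rho / (1 - rho)).
    + assert (E1 : X - x0 + rho / (1 - rho) * Y <= rho / (1 - rho)).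
      { apply Rmult_le_reg_l with (1 - rho); [lra|].
        replace ((1 - rho) * (X - x0 + rho / (1 - rho) * Y))
          with ((1 - rho) * (X - x0) + rho * Y) by (field; lra).
        replace ((1 - rho) * (rho / (1 - rho))) with rho by (field; lra).
        exact HP'. }
      assert (E2 : 1 / (1 + x0) * Y <= 1 / (1 + x0)).
      { rewrite <- (Rmult_1_r (1 / (1 + x0))) at 2.
        apply Rmult_le_compat_l; [|lra].
        apply Rlt_le, Rdiv_lt_0_compat; lra. }
      lra.
    + replace ((3 - rho) / (2 * (1 - rho))) with (3 / 2 + rho / (1 - rho))
        by (field; lra).
      apply Rplus_le_compat_r.
      (* The defect 3/2 - x0 - 1/(1 + x0) factors so that its sign on [0,1] is visible; it vanishes
         at x0 = 1, the monomial case. *)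
      replace (x0 + 1 / (1 + x0))
        with (3 / 2 - (1 - x0) * (1 + 2 * x0) / (2 * (1 + x0))) by (field; lra).
      assert (0 <= (1 - x0) * (1 + 2 * x0) / (2 * (1 + x0))).
      { apply Rmult_le_pos; [nra|]. apply Rlt_le, Rinv_0_lt_compat. lra. }
      lra.
  - apply is_lim_seq_plus'; [exact HX|].
    apply (is_lim_seq_scal_l _ kappa (Finite _)). exact HY.
  - apply is_lim_seq_const.
Qed.

(** * Convergence and upper bound of M for bounded lacunary series *)

Lemma M_terms (k m p : nat) (a : nat -> C) (r : R) :
  let x := fun i => Cmod (lacunary_coef k m p a i) in
  (forall i, from k (M_term1 m p a r) i = r ^ (p * k + m) * (x i * (r ^ p) ^ i)) /\
  (forall i, from k (M_term2 k m p a r) i =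
     r ^ (p * k + m) * (x i ^ 2 * (r ^ p) ^ (2 * i))).
Proof.
  intros x. split; intros i; unfold from, M_term1, M_term2, x, lacunary_coef;
    rewrite <- pow_mult.
  - replace (p * (k + i) + m)%nat with ((p * k + m) + p * i)%nat at 2 by lia.
    rewrite pow_add. ring.
  (* The subtraction is not truncated here: 2(k + i) - k = k + 2i. *)
  - replace (p * (2 * (k + i) - k) + m)%nat with ((p * k + m) + p * (2 * i))%nat
      by nia.
    rewrite pow_add. ring.
Qed.

Lemma pow_p_lt_1 (r : R) (p : nat) : (1 <= p)%nat -> 0 <= r < 1 -> 0 <= r ^ p < 1.
Proof.
  intros Hp Hr. split; [apply pow_le; lra|].
  destruct p as [|p]; [lia|]. simpl.
  assert (0 <= r ^ p <= 1).
  { split; [apply pow_le; lra|]. rewrite <- (pow1 p). apply pow_incr. lra. }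
  nra.
Qed.

Lemma unit_coef_series (x : nat -> R) (rho : R) :
  (forall i, 0 <= x i <= 1) -> 0 <= rho < 1 ->
  ex_series (fun i => x i * rho ^ i) /\ ex_series (fun i => x i ^ 2 * rho ^ (2 * i)).
Proof.
  intros Hx Hr.
  assert (Hg : ex_series (fun i => rho ^ i)).
  { apply ex_series_geom. rewrite Rabs_pos_eq; lra. }
  split; apply (ex_series_le (V := R_CompleteNormedModule) _ (fun i => rho ^ i));
    auto; intros i; specialize (Hx i);
    assert (H0 : 0 <= rho ^ i <= 1)
      by (split; [apply pow_le; lra|]; rewrite <- (pow1 i); apply pow_incr; lra).
  - change (Rabs (x i * rho ^ i) <= rho ^ i). rewrite Rabs_pos_eq; nra.
  - change (Rabs (x i ^ 2 * rho ^ (2 * i)) <= rho ^ i).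
    replace (2 * i)%nat with (i + i)%nat by lia. rewrite pow_add.
    replace (x i ^ 2 * (rho ^ i * rho ^ i)) with ((x i * rho ^ i) * (x i * rho ^ i))
      by ring.
    assert (0 <= x i * rho ^ i <= rho ^ i) by nra.
    rewrite Rabs_pos_eq; nra.
Qed.

(** Carlson's inequality with q = i and s = 2i + 1 bounds the sum of squares up to i by 1. This
    covers i = 0 too, although s = 0 is never admissible. *)
Lemma lacunary_coef_le_1 (k m p : nat) (a : nat -> C) (h : C -> C) (i : nat) :
  (1 <= p)%nat -> lacunary_expansion k m p a h ->
  (forall z, Defs.D z -> Cmod (h z) <= 1) ->
  0 <= Cmod (lacunary_coef k m p a i) <= 1.
Proof.
  intros Hp Hh Hb. split; [apply Cmod_ge_0|].
  assert (H : Cmod (lacunary_coef k m p a i) ^ 2 <= sqnorm (lacunary_coef k m p a) i).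
  { unfold sqnorm. rewrite sum_n_Reals. destruct i as [|i]; [apply Rle_refl|].
    rewrite tech5.
    assert (0 <= sum_f_R0 (fun j => Cmod (lacunary_coef k m p a j) ^ 2) i)
      by (apply cond_pos_sum; intros; apply pow2_ge_0).
    lra. }
  generalize (carlson_lacunary k m p a h i (S (2 * i)) Hp Hh Hb ltac:(lia))
    (Cmod_ge_0 (lacunary_coef k m p a (S (2 * i))))
    (Cmod_ge_0 (lacunary_coef k m p a i)).
  nra.
Qed.

Lemma lacunary_M_converges (k m p : nat) (a : nat -> C) (h : C -> C) (r : R) :
  (1 <= p)%nat -> lacunary_expansion k m p a h ->
  (forall z, Defs.D z -> Cmod (h z) <= 1) ->
  0 <= r < 1 -> M_converges k m p a r.
Proof.
  intros Hp Hh Hb Hr. destruct (M_terms k m p a r) as [E1 E2].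
  destruct (unit_coef_series (fun i => Cmod (lacunary_coef k m p a i)) (r ^ p)
    (fun i => lacunary_coef_le_1 k m p a h i Hp Hh Hb) (pow_p_lt_1 r p Hp Hr))
    as [H1 H2].
  split.
  - apply (ex_series_ext _ _ (fun i => eq_sym (E1 i))).
    now apply (ex_series_scal_l (V := R_NormedModule)).
  - apply (ex_series_ext _ _ (fun i => eq_sym (E2 i))).
    now apply (ex_series_scal_l (V := R_NormedModule)).
Qed.

Lemma lacunary_M_le (k m p : nat) (a : nat -> C) (h : C -> C) (r : R) :
  (1 <= p)%nat -> lacunary_expansion k m p a h ->
  (forall z, Defs.D z -> Cmod (h z) <= 1) ->
  0 <= r < 1 ->
  M k m p a r <= r ^ (p * k + m) * ((3 - r ^ p) / (2 * (1 - r ^ p))).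
Proof.
  intros Hp Hh Hb Hr. destruct (M_terms k m p a r) as [E1 E2].
  pose proof (pow_p_lt_1 r p Hp Hr) as Hrho.
  destruct (unit_coef_series (fun i => Cmod (lacunary_coef k m p a i)) (r ^ p)
    (fun i => lacunary_coef_le_1 k m p a h i Hp Hh Hb) Hrho) as [H1 H2].
  unfold M. rewrite (Series_ext _ _ E1), (Series_ext _ _ E2), !Series_scal_l.
  replace (a (p * k + m)%nat) with (lacunary_coef k m p a 0)
    by (unfold lacunary_coef; now rewrite Nat.add_0_r).
  match goal with |- ?A * ?X + ?K * (?A * ?Y) <= _ =>
    replace (A * X + K * (A * Y)) with (A * (X + K * Y)) by ring end.
  apply Rmult_le_compat_l; [apply pow_le; lra|].
  apply (bohr_bound (fun i => Cmod (lacunary_coef k m p a i))); auto.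
  - intros i. apply Cmod_ge_0.
  - intros q s Hq. rewrite <- sum_n_Reals.
    exact (carlson_lacunary k m p a h q s Hp Hh Hb Hq).
Qed.

(** In terms of u = t^p and v = t^N, the expression 1 - u - v(3 - u) is nonincreasing in u and
    strictly decreasing in v on the unit square. *)
Lemma theta_root_decreasing (N p : nat) (s t : R) :
  (1 <= p)%nat -> (1 <= N)%nat -> 0 <= s -> s < t -> t <= 1 ->
  (1 - t ^ p) - t ^ N * (3 - t ^ p) < (1 - s ^ p) - s ^ N * (3 - s ^ p).
Proof.
  intros Hp HN Hs Hst Ht.
  assert (L : forall n, (1 <= n)%nat -> 0 <= s ^ n < t ^ n /\ t ^ n <= 1).
  { intros n Hn. repeat split.
    - now apply pow_le.
    - destruct n as [|n]; [lia|]. simpl.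
      assert (s ^ n <= t ^ n) by (apply pow_incr; lra).
      assert (0 < t ^ n) by (apply pow_lt; lra).
      nra.
    - rewrite <- (pow1 n). apply pow_incr. lra. }
  generalize (L p Hp) (L N HN). nra.
Qed.

Lemma theta_root_exists (N p : nat) :
  (1 <= p)%nat -> (1 <= N)%nat ->
  exists t, 0 < t < 1 /\ (1 - t ^ p) - t ^ N * (3 - t ^ p) = 0.
Proof.
  intros Hp HN.
  pose (F := fun t => (1 - t ^ p) - t ^ N * (3 - t ^ p)).
  assert (F0 : F 0 = 1).
  { unfold F. rewrite !pow_ne_zero by lia. ring. }
  assert (F1 : F 1 = -2).
  { unfold F. rewrite !pow1. ring. }
  destruct (IVT_cor F 0 1) as [t [Ht E]].
  - unfold F. reg.
  - lra.
  - rewrite F0, F1. lra.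
  - exists t. split; [|exact E].
    split; apply Rnot_le_lt; intros H.
    + replace t with 0 in E by lra. lra.
    + replace t with 1 in E by lra. lra.
Qed.
(** * Sharpness: monomials *)

Lemma is_series_first {K : AbsRing} {V : NormedModule K} (u : nat -> V) :
  (forall i, u (S i) = zero) -> is_series u (u 0%nat).
Proof.
  intros Hu. unfold is_series.
  apply (filterlim_ext (fun _ => u 0%nat)); [|apply filterlim_const].
  intros n. induction n as [|n IH].
  - now rewrite sum_O.
  - now rewrite sum_Sn, <- IH, Hu, plus_zero_r.
Qed.

(** The codomain is C as a module over itself, the structure to which the product rule
    [is_derive_mult] applies. At n = 0 the factor [INR 0] absorbs the truncated [pred 0]. *)
Lemma is_derive_Cpow_ring (c : C) (n : nat) (z : C) :
  is_derive (K := C_AbsRing) (V := AbsRing_NormedModule C_AbsRing)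
    (fun z => c * z ^ n)%C z (c * RtoC (INR n) * z ^ pred n)%C.
Proof.
  induction n as [|n IH].
  - replace (c * RtoC (INR 0) * z ^ pred 0)%C with (RtoC 0) by (simpl; ring).
    apply (is_derive_const (K := C_AbsRing) (V := AbsRing_NormedModule C_AbsRing)
             (c * z ^ 0)%C).
  - apply (is_derive_ext (K := C_AbsRing) (V := AbsRing_NormedModule C_AbsRing)
             (fun z => z * (c * z ^ n))%C).
    { intros t. rewrite Cpow_S. cring. }
    replace (c * RtoC (INR (S n)) * z ^ pred (S n))%C
      with (1 * (c * z ^ n) + z * (c * RtoC (INR n) * z ^ pred n))%C.
    + refine (is_derive_mult (K := C_AbsRing) (fun z => z) (fun z => c * z ^ n)%C
               z (RtoC 1) _ _ IH Cmult_comm).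
      apply (is_derive_id (K := C_AbsRing)).
    + rewrite S_INR, RtoC_plus. destruct n as [|n]; simpl pred.
      * simpl. ring.
      * rewrite Cpow_S. ring.
Qed.

(* [C_NormedModule] and [AbsRing_NormedModule C_AbsRing] are distinct structures with
   the same norm, and differentiability only depends on the norm of the codomain. *)
Lemma is_derive_Cpow (c : C) (n : nat) (z : C) :
  is_derive (K := C_AbsRing) (V := C_NormedModule) (fun z => c * z ^ n)%C z
    (c * RtoC (INR n) * z ^ pred n)%C.
Proof.
  destruct (is_derive_Cpow_ring c n z) as [[L1 L2 L3] H].
  split; [split; [exact L1|exact L2|exact L3]|exact H].
Qed.

(** A general constant [c] lets the induction absorb the factor n produced by each differentiation;
    the exponent stays positive because i < n. *)
Lemma iter_C_derive_Cpow (i n : nat) (c : C) :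
  (i < n)%nat -> Nat.iter i C_derive (fun z => c * z ^ n)%C (RtoC 0) = RtoC 0.
Proof.
  revert n c. induction i as [|i IH]; intros n c Hi.
  - simpl. destruct n; [lia|]. simpl. ring.
  - rewrite Nat.iter_succ_r.
    replace (C_derive (fun z => c * z ^ n)%C)
      with (fun z => c * RtoC (INR n) * z ^ pred n)%C.
    + apply IH. lia.
    + apply functional_extensionality. intros z. symmetry.
      apply is_C_derive_unique, is_derive_Cpow.
Qed.

Lemma monomial_class_Bj (c : C) (n : nat) :
  Cmod c = 1 -> class_Bj n (fun z => c * z ^ n)%C.
Proof.
  intros Hc. split; [split|].
  - intros z _. eexists. apply is_derive_Cpow.
  - intros z Hz. rewrite Cmod_mult, Hc, Cmod_pow, Rmult_1_l, <- (pow1 n).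
    apply pow_incr. split; [apply Cmod_ge_0|]. now apply Rlt_le.
  - intros i Hi. now apply iter_C_derive_Cpow.
Qed.

Lemma monomial_coeff_lacunary (k m p i : nat) (c : C) : (1 <= p)%nat ->
  lacunary_coef k m p (monomial_coeff (p * k + m) c) i =
  if Nat.eqb i 0 then c else RtoC 0.
Proof.
  intros Hp. unfold lacunary_coef, monomial_coeff.
  destruct (Nat.eqb_spec i 0); destruct (Nat.eqb_spec (p * (k + i) + m) (p * k + m));
    auto; nia.
Qed.

Lemma monomial_lacunary_expansion (k m p : nat) (c : C) : (1 <= p)%nat ->
  lacunary_expansion k m p (monomial_coeff (p * k + m) c)
    (fun z => c * z ^ (p * k + m))%C.
Proof.
  intros Hp z _.
  pose (u := from k (fun n => (monomial_coeff (p * k + m) c (p * n + m)%nat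
                               * z ^ (p * n + m))%C)).
  assert (E : forall i, u i = (lacunary_coef k m p (monomial_coeff (p * k + m) c) i
                               * z ^ (p * (k + i) + m))%C) by reflexivity.
  replace (c * z ^ (p * k + m))%C with (u 0%nat).
  - apply (is_series_first (K := C_AbsRing) (V := C_NormedModule) u).
    intros i. rewrite E, monomial_coeff_lacunary by auto. apply Cmult_0_l.
  - rewrite E, monomial_coeff_lacunary by auto. now rewrite Nat.add_0_r.
Qed.

(** Allowing complex [mu] makes the family closed under both partial derivatives, and the factor -i
    yields imaginary parts as well. *)
Definition re_monomial (mu : C) (n : nat) (x y : R) : R := Re (mu * (x, y) ^ n)%C.

Lemma re_monomial_S (mu : C) (n : nat) (x y : R) :
  re_monomial mu (S n) x y =
  x * re_monomial mu n x y + y * re_monomial (mu * Ci)%C n x y.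
Proof.
  unfold re_monomial. rewrite Cpow_S.
  rewrite !re_mult, !im_mult. simpl. ring.
Qed.

Lemma re_monomial_scal (r : R) (mu : C) (n : nat) (x y : R) :
  re_monomial (mu * RtoC r)%C n x y = r * re_monomial mu n x y.
Proof.
  unfold re_monomial.
  replace (mu * RtoC r * (x, y) ^ n)%C with (RtoC r * (mu * (x, y) ^ n))%C by ring.
  apply re_scal_l.
Qed.

(** The recurrence [re_monomial_S] reduces complex powers to the real product rule; the extra [Ci]
    in the y-derivative is the Cauchy-Riemann relation. *)
Lemma is_derive_re_monomial (n : nat) : forall (mu : C) (x y : R),
  is_derive (fun t => re_monomial mu n t y) x
    (re_monomial (mu * RtoC (INR n))%C (pred n) x y) /\
  is_derive (fun t => re_monomial mu n x t) y
    (re_monomial (mu * RtoC (INR n) * Ci)%C (pred n) x y).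
Proof.
  induction n as [|n IH]; intros mu x y.
  - simpl INR. split.
    + replace (re_monomial _ _ x y) with 0
        by (rewrite re_monomial_scal; ring).
      apply (is_derive_const (V := R_NormedModule) (re_monomial mu 0 0 0)).
    + replace (mu * RtoC 0 * Ci)%C with (mu * RtoC 0)%C by ring.
      replace (re_monomial _ _ x y) with 0
        by (rewrite re_monomial_scal; ring).
      apply (is_derive_const (V := R_NormedModule) (re_monomial mu 0 0 0)).
  - destruct (IH mu x y) as [D1 D2].
    destruct (IH (mu * Ci)%C x y) as [D3 D4].
    (* This folds the differentiated factors back into n times the monomial; n = 0 is separate
       because [pred 0] is 0. *)
    assert (Hpred : forall nu, x * re_monomial (nu * RtoC (INR n))%C (pred n) x y
        + y * re_monomial (nu * RtoC (INR n) * Ci)%C (pred n) x y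
        = INR n * re_monomial nu n x y).
    { intros nu. destruct n as [|n].
      - simpl INR. replace (nu * RtoC 0 * Ci)%C with (nu * RtoC 0)%C by ring.
        rewrite !re_monomial_scal. ring.
      - simpl pred. rewrite <- re_monomial_S. apply re_monomial_scal. }
    simpl pred.
    replace (mu * RtoC (INR (S n)) * Ci)%C with (mu * Ci * RtoC (INR (S n)))%C by ring.
    rewrite !re_monomial_scal, S_INR.
    split.
    + apply (is_derive_ext (fun t => t * re_monomial mu n t y
                                     + y * re_monomial (mu * Ci)%C n t y)).
      { intros t. symmetry. apply re_monomial_S. }
      replace ((INR n + 1) * re_monomial mu n x y) with
        ((1 * re_monomial mu n x y
          + x * re_monomial (mu * RtoC (INR n))%C (pred n) x y)
         + y * re_monomial (mu * Ci * RtoC (INR n))%C (pred n) x y).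
      * apply (is_derive_plus (V := R_NormedModule)).
        -- exact (is_derive_mult (K := R_AbsRing) (fun t => t)
             (fun t => re_monomial mu n t y) x 1 _
             (is_derive_id (K := R_AbsRing) x) D1 Rmult_comm).
        -- now apply (is_derive_scal (fun t => re_monomial (mu * Ci)%C n t y)).
      * rewrite Rmult_plus_distr_r, <- Hpred.
        replace (mu * Ci * RtoC (INR n))%C with (mu * RtoC (INR n) * Ci)%C by ring.
        ring.
    + apply (is_derive_ext (fun t => x * re_monomial mu n x t
                                     + t * re_monomial (mu * Ci)%C n x t)).
      { intros t. symmetry. apply re_monomial_S. }
      replace ((INR n + 1) * re_monomial (mu * Ci)%C n x y) with
        (x * re_monomial (mu * RtoC (INR n) * Ci)%C (pred n) x y
         + (1 * re_monomial (mu * Ci)%C n x y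
            + y * re_monomial (mu * Ci * RtoC (INR n) * Ci)%C (pred n) x y)).
      * apply (is_derive_plus (V := R_NormedModule)).
        -- now apply (is_derive_scal (fun t => re_monomial mu n x t)).
        -- exact (is_derive_mult (K := R_AbsRing) (fun t => t)
             (fun t => re_monomial (mu * Ci)%C n x t) y 1 _
             (is_derive_id (K := R_AbsRing) y) D4 Rmult_comm).
      * rewrite Rmult_plus_distr_r, <- Hpred.
        replace (mu * Ci * RtoC (INR n))%C with (mu * RtoC (INR n) * Ci)%C by ring.
        ring.
Qed.

Lemma continuity_2d_re_monomial (n : nat) : forall (mu : C) (x y : R),
  continuity_2d_pt (re_monomial mu n) x y.
Proof.
  induction n as [|n IH]; intros mu x y.
  - apply (continuity_2d_pt_const x y (Re (mu * 1)%C)).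
  - apply (continuity_2d_pt_ext (fun u v => u * re_monomial mu n u v
                                   + v * re_monomial (mu * Ci)%C n u v)).
    { intros u v. symmetry. apply re_monomial_S. }
    apply continuity_2d_pt_plus; apply continuity_2d_pt_mult; auto.
    + apply continuity_2d_pt_id1.
    + apply continuity_2d_pt_id2.
Qed.

Lemma Derive_re_monomial_x (mu : C) (n : nat) :
  (fun u v => Derive (fun t => re_monomial mu n t v) u) =
  re_monomial (mu * RtoC (INR n))%C (pred n).
Proof.
  apply functional_extensionality; intros u.
  apply functional_extensionality; intros v.
  exact (is_derive_unique _ _ _ (proj1 (is_derive_re_monomial n mu u v))).
Qed.

Lemma Derive_re_monomial_y (mu : C) (n : nat) :
  (fun u v => Derive (fun t => re_monomial mu n u t) v) =
  re_monomial (mu * RtoC (INR n) * Ci)%C (pred n).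
Proof.
  apply functional_extensionality; intros u.
  apply functional_extensionality; intros v.
  exact (is_derive_unique _ _ _ (proj2 (is_derive_re_monomial n mu u v))).
Qed.

(** The partial derivatives stay in the family, so induction on the order closes once it ranges over
    all [mu] and [n]. *)
Lemma ex_diff_n_re_monomial (l : nat) : forall (mu : C) (n : nat) (x y : R),
  ex_diff_n (re_monomial mu n) l x y.
Proof.
  induction l as [|l IH]; intros mu n x y; simpl;
    (split; [apply continuity_2d_re_monomial|auto]).
  rewrite Derive_re_monomial_x, Derive_re_monomial_y.
  split; [|split; [|split; apply IH]]; eexists.
  - exact (proj1 (is_derive_re_monomial n mu x y)).
  - exact (proj2 (is_derive_re_monomial n mu x y)).
Qed.

Lemma laplacian_re_monomial (mu : C) (n : nat) (x y : R) :
  laplacian (re_monomial mu n) x y = 0.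
Proof.
  unfold laplacian, partial_derive. simpl.
  rewrite (Derive_ext _ (fun t => re_monomial (mu * RtoC (INR n))%C (pred n) t y)).
  2:{ intros t.
      exact (is_derive_unique _ _ _ (proj1 (is_derive_re_monomial n mu t y))). }
  rewrite (Derive_ext (fun t => Derive _ t)
             (fun t => re_monomial (mu * RtoC (INR n) * Ci)%C (pred n) x t)).
  2:{ intros t.
      exact (is_derive_unique _ _ _ (proj2 (is_derive_re_monomial n mu x t))). }
  rewrite !(is_derive_unique _ _ _ (proj1 (is_derive_re_monomial _ _ _ _))).
  rewrite !(is_derive_unique _ _ _ (proj2 (is_derive_re_monomial _ _ _ _))).
  (* The two second derivatives have coefficients nu and i^2 nu = -nu, so they cancel. *)
  set (nu := (mu * RtoC (INR n) * RtoC (INR (pred n)))%C).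
  replace (mu * RtoC (INR n) * Ci * RtoC (INR (pred n)) * Ci)%C
    with (nu * RtoC (-1))%C.
  - rewrite re_monomial_scal. ring.
  - replace (RtoC (-1)) with (Ci * Ci)%C.
    + unfold nu. ring.
    + unfold Ci, Cmult, RtoC; simpl. f_equal; ring.
Qed.

Lemma monomial_sum_harmonic (lambda : C) (n : nat) :
  harmonic_on_D (fun z => z ^ n + Cconj (lambda * z ^ n))%C.
Proof.
  assert (H : forall mu, real_harmonic_on_D (re_monomial mu n)).
  { intros mu x y _. split.
    - apply ex_diff_n_re_monomial.
    - apply laplacian_re_monomial. }
  (* With w = z^n, the real part is Re((1 + lambda) w), and the imaginary part is Im((1 - lambda) w)
     = Re(-i (1 - lambda) w). *)
  split.
  - replace (fun x y => _) with (re_monomial (1 + lambda)%C n); auto.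
    apply functional_extensionality; intros x.
    apply functional_extensionality; intros y.
    unfold re_monomial. rewrite re_plus, re_conj, <- re_plus. f_equal. ring.
  - replace (fun x y => _) with (re_monomial (- Ci * (1 - lambda))%C n); auto.
    apply functional_extensionality; intros x.
    apply functional_extensionality; intros y.
    unfold re_monomial. generalize ((x, y) ^ n)%C. intros [u v].
    destruct lambda as [s t]. unfold Re, Im, Ci, RtoC; simpl. ring.
Qed.

(** Only the term n = k survives, both series equal r^(pk+m), and 1 + 1/2 + rho/(1 - rho) = (3 -
    rho)/(2(1 - rho)) with rho = r^p. *)
Lemma M_monomial (k m p : nat) (c : C) (r : R) :
  (1 <= p)%nat -> Cmod c = 1 -> 0 <= r < 1 ->
  M k m p (monomial_coeff (p * k + m) c) r =
  r ^ (p * k + m) * ((3 - r ^ p) / (2 * (1 - r ^ p))).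
Proof.
  intros Hp Hc Hr. pose proof (pow_p_lt_1 r p Hp Hr) as Hrho.
  set (a := monomial_coeff (p * k + m) c).
  destruct (M_terms k m p a r) as [E1 E2].
  assert (Ea : forall i, Cmod (lacunary_coef k m p a i) =
                         if Nat.eqb i 0 then 1 else 0).
  { intros i. unfold a. rewrite monomial_coeff_lacunary by auto.
    destruct (Nat.eqb i 0); auto. apply Cmod_0. }
  assert (S1 : Series (from k (M_term1 m p a r)) = r ^ (p * k + m)).
  { rewrite (is_series_unique _ (from k (M_term1 m p a r) 0%nat)).
    - rewrite E1, Ea. simpl. ring.
    - apply (is_series_first (V := R_NormedModule)).
      intros i. rewrite E1, Ea. unfold zero; simpl. ring. }
  assert (S2 : Series (from k (M_term2 k m p a r)) = r ^ (p * k + m)).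
  { rewrite (is_series_unique _ (from k (M_term2 k m p a r) 0%nat)).
    - rewrite E2, Ea. simpl. ring.
    - apply (is_series_first (V := R_NormedModule)).
      intros i. rewrite E2, Ea. unfold zero; simpl. ring. }
  unfold M. rewrite S1, S2.
  replace (a (p * k + m)%nat) with (lacunary_coef k m p a 0)
    by (unfold lacunary_coef; now rewrite Nat.add_0_r).
  rewrite Ea. simpl Nat.eqb. cbv iota. field. lra.
Qed.

Theorem theorem5 (k m p : nat)
    (hk : (2 <= k)%nat) (hm : (1 <= m)%nat) (hp : (1 <= p)%nat)
    (hmp : (m <= p)%nat) :
  exists theta : R,
    unique (fun t : R => 0 < t < 1 /\
              (1 - t ^ p) - t ^ (p * k + m) * (3 - t ^ p) = 0) theta /\
    (forall (f h g : C -> C) (a b : nat -> C), setting k m p f h g a b ->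
       forall r : R, 0 <= r < 1 ->
         M_converges k m p a r /\ M_converges k m p b r) /\
    (forall (f h g : C -> C) (a b : nat -> C), setting k m p f h g a b ->
       forall r : R, 0 <= r <= theta -> M k m p a r + M k m p b r <= 1) /\
    (forall theta' : R, theta < theta' < 1 ->
       ~ (forall (f h g : C -> C) (a b : nat -> C), setting k m p f h g a b ->
            forall r : R, 0 <= r <= theta' -> M k m p a r + M k m p b r <= 1)) /\
    (forall lambda : C, Cmod lambda = 1 ->
       let N := (p * k + m)%nat in
       let h := fun z : C => (z ^ N)%C in
       let g := fun z : C => (lambda * h z)%C in
       let f := fun z : C => (h z + Cconj (lambda * h z))%C in
       let a := monomial_coeff N (RtoC 1) in
       let b := monomial_coeff N lambda in
       setting k m p f h g a b /\
       forall r : R, theta < r < 1 -> 1 < M k m p a r + M k m p b r).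
Proof.
  destruct (theta_root_exists (p * k + m) p hp ltac:(lia)) as [theta [Ht Et]].
  assert (Hdec : forall s t, 0 <= s -> s < t -> t <= 1 ->
    (1 - t ^ p) - t ^ (p * k + m) * (3 - t ^ p)
    < (1 - s ^ p) - s ^ (p * k + m) * (3 - s ^ p)).
  { intros s t. apply theta_root_decreasing; lia. }
  (* Proved for every unimodular lambda at once: this is the extremal family, and lambda = 1 gives
     the sharpness of theta. *)
  assert (Hmono : forall lambda : C, Cmod lambda = 1 ->
    setting k m p
      (fun z => z ^ (p * k + m) + Cconj (lambda * z ^ (p * k + m)))%C
      (fun z => z ^ (p * k + m))%C (fun z => lambda * z ^ (p * k + m))%C
      (monomial_coeff (p * k + m) (RtoC 1)) (monomial_coeff (p * k + m) lambda) /\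
    forall r, theta < r < 1 ->
      1 < M k m p (monomial_coeff (p * k + m) (RtoC 1)) r
          + M k m p (monomial_coeff (p * k + m) lambda) r).
  { intros lambda Hl.
    assert (E1 : (fun z => z ^ (p * k + m))%C
                 = (fun z => RtoC 1 * z ^ (p * k + m))%C).
    { apply functional_extensionality. intros z. ring. }
    split.
    - split; [apply monomial_sum_harmonic|]. split; [reflexivity|].
      split; [|split; [|split]].
      + rewrite E1. now apply monomial_lacunary_expansion.
      + now apply monomial_lacunary_expansion.
      + rewrite E1. apply monomial_class_Bj, Cmod_1.
      + now apply monomial_class_Bj.
    - intros r Hr. rewrite !M_monomial by (auto using Cmod_1; lra).
      pose proof (pow_p_lt_1 r p hp ltac:(lra)) as Hrho.
      replace (_ + _)
        with (r ^ (p * k + m) * (3 - r ^ p) / (1 - r ^ p)) by (field; lra).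
      (* The sum exceeds 1 exactly when the decreasing expression is negative, which happens past
         its root theta. *)
      apply Rlt_div_r; [lra|].
      generalize (Hdec theta r ltac:(lra) ltac:(lra) ltac:(lra)). lra. }
  exists theta. split; [|split; [|split; [|split]]].
  - split; [now split|]. intros t [Ht' Et'].
    destruct (Rtotal_order theta t) as [L|[E|L]]; auto; exfalso.
    + generalize (Hdec theta t ltac:(lra) L ltac:(lra)). lra.
    + generalize (Hdec t theta ltac:(lra) L ltac:(lra)). lra.
  - intros f h g a b (_ & _ & Ha & Hb & [[_ Bh] _] & [[_ Bg] _]) r Hr.
    split; eapply lacunary_M_converges; eauto.
  - intros f h g a b (_ & _ & Ha & Hb & [[_ Bh] _] & [[_ Bg] _]) r Hr.
    generalize (lacunary_M_le k m p a h r hp Ha Bh ltac:(lra))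
      (lacunary_M_le k m p b g r hp Hb Bg ltac:(lra)).
    pose proof (pow_p_lt_1 r p hp ltac:(lra)) as Hrho.
    assert (L : r ^ (p * k + m) * (3 - r ^ p) / (1 - r ^ p) <= 1).
    { apply Rle_div_l; [lra|].
      destruct (Rle_lt_or_eq_dec r theta ltac:(lra)) as [L| ->]; [|lra].
      generalize (Hdec r theta ltac:(lra) L ltac:(lra)). lra. }
    replace (r ^ (p * k + m) * (3 - r ^ p) / (1 - r ^ p)) with
      (r ^ (p * k + m) * ((3 - r ^ p) / (2 * (1 - r ^ p)))
       + r ^ (p * k + m) * ((3 - r ^ p) / (2 * (1 - r ^ p)))) in L by (field; lra).
    lra.
  - intros theta' Hth Hall.
    destruct (Hmono (RtoC 1) Cmod_1) as [Hset Hgt].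
    (* The contradiction is already reached at the radius r = theta' itself. *)
    generalize (Hall _ _ _ _ _ Hset theta' ltac:(lra)) (Hgt theta' Hth). lra.
  - exact Hmono.
Qed.
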